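(* In the parameter space $\mathrm{Sub}(\mathbb{Z}^{(\mathbb{N})})$, the set of $H$ such that $\mathbb{Z}^{(\mathbb{N})}/H$ is a torsion group and the set of $H$ such that $\mathbb{Z}^{(\mathbb{N})}/H$ is a divisible group are both $\Pi^0_2$-complete.
   Context: $\mathbb{Z}^{(\mathbb{N})}=\bigoplus_{n\in\mathbb{N}}\mathbb{Z}e_n$ and $\mathrm{Sub}(\mathbb{Z}^{(\mathbb{N})})$ is the set of its subgroups, a closed subset of $2^{\mathbb{Z}^{(\mathbb{N})}}$ with the product topology. A subset $S$ of a Polish space $X$ is $\Pi^0_2$-complete if $S$ is $\Pi^0_2$ ($G_\delta$) and for every $\Pi^0_2$ subset $B$ of any Polish space $Y$ there is a continuous $f:Y\to X$ with $f^{-1}(S)=B$.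
   Formalization: In the definition of Π^0_2-completeness, Y ranges over zero-dimensional Polish spaces (those with a clopen basis) instead of any Polish space; for Y = ℝ and B = the irrationals the literal claim fails, since every continuous map from ℝ to Sub(ℤ^(ℕ)) is constant. *)

(* Defs.v *)
From HB Require Import structures.
From mathcomp Require Import all_boot all_order all_algebra ring_quotient.
From mathcomp Require Import all_classical all_reals.
From mathcomp Require Import topology borel_hierarchy.
From mathcomp Require Import freeg.

Set Implicit Arguments.
Unset Strict Implicit.
Unset Printing Implicit Defensive.

Import GRing.Theory Num.Theory.

Local Open Scope classical_set_scope.
Local Open Scope ring_scope.

Definition separable (T : topologicalType) : Prop :=
  exists2 D : set T, countable D & dense D.

Definition is_metric (R : realType) (T : Type) (d : T -> T -> R) : Prop :=
  [/\ forall x y, d x y = 0 <-> x = y,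
      forall x y, d x y = d y x &
      forall x y z, d x z <= d x y + d y z].

Definition metric_induces (R : realType) (T : topologicalType)
    (d : T -> T -> R) : Prop :=
  forall (x : T) (A : set T),
    nbhs x A <-> exists2 e : R, 0 < e & [set y | d x y < e] `<=` A.

Definition metric_complete (R : realType) (T : topologicalType)
    (d : T -> T -> R) : Prop :=
  forall u : nat -> T,
    (forall e : R, 0 < e -> exists N : nat, forall m n : nat,
       (N <= m)%N -> (N <= n)%N -> d (u m) (u n) < e) ->
    exists l : T, u @ \oo --> l.

Definition completely_metrizable (R : realType) (T : topologicalType) : Prop :=
  exists d : T -> T -> R,
    [/\ is_metric d, metric_induces d & metric_complete d].

Definition polish (R : realType) (T : topologicalType) : Prop :=
  separable T /\ completely_metrizable R T.

(* Zero-dimensionality in the sense of descriptive set theory; the library's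
   [zero_dimensional] only asks that clopen sets separate points, which is
   strictly weaker for noncompact Polish spaces. *)
Definition clopen_basis (T : topologicalType) : Prop :=
  exists2 B : set (set T), basis B & B `<=` clopen.

(* Reductions range over the zero-dimensional Polish spaces only: a connected
   space such as the real line has no nonconstant continuous map into a
   zero-dimensional space, so no subset of the latter could otherwise be
   complete. *)
Definition Pi02_complete (R : realType) (X : topologicalType) (S : set X)
    : Prop :=
  [/\ polish R X,
      Gdelta S &
      forall (Y : topologicalType) (B : set Y),
        polish R Y -> clopen_basis Y -> Gdelta B ->
        exists2 f : Y -> X, continuous f & f @^-1` S = B].

Definition subgroups (G : zmodType) : set {ptws G -> bool} :=
  [set A | zmod_closed (A : {pred G})].

(* A [set_type], hence it carries the subspace topology of 2^G. *)
Definition SubGrp (G : zmodType) : topologicalType := set_type (@subgroups G).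

Definition subgroup_pred (G : zmodType) (H : SubGrp G) : {pred G} := \val H.

Lemma subgroup_pred_zmod_closed (G : zmodType) (H : SubGrp G) :
  zmod_closed (subgroup_pred H).
Proof. exact: (set_mem (valP H)). Qed.

HB.instance Definition _ (G : zmodType) (H : SubGrp G) :=
  GRing.isZmodClosed.Build G (subgroup_pred H) (subgroup_pred_zmod_closed H).

Definition quotient_group (G : zmodType) (H : SubGrp G) : zmodType :=
  Quotient.quot (subgroup_pred H).

Definition torsion_group (A : zmodType) : Prop :=
  forall x : A, exists2 n : nat, (0 < n)%N & x *+ n = 0.

Definition divisible_group (A : zmodType) : Prop :=
  forall n : nat, (0 < n)%N -> forall x : A, exists y : A, y *+ n = x.

Definition ZN : zmodType := {freeg nat / int}.

(* Main.v *)
(** A subgroup of a countable group G is a point of the Cantor space 2^G; two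
    subgroups are close when they agree on many elements in an enumeration of G,
    which gives a complete ultrametric. Both sets are G_delta because "torsion"
    and "divisible" are of the form "for all g (and n) there is a witness whose
    membership in H is an open condition".

    Hardness. In a zero-dimensional Polish space Y every open set is a countable
    union of clopen sets, so a G_delta set B is the set of the y such that for
    every n some clopen event c n k occurs at y.
    - Torsion: send y to the subgroup of the x such that every coordinate x_n is a
      multiple of k + 1, where k is the first time with c n k y, and x_n = 0 if
      there is no such time. The quotient is a direct sum of the cyclic groups
      Z/(k+1) or Z. Membership of x depends on y through k < |x_n| only, whence
      continuity.
    - Divisible: send y to the kernel of the map Z^(N) -> Q whose value at the
      generator coded by (n, k) is 1/n! if the events of the rows j < n all occur
      before time k, and 1 otherwise. The image is Q if y is in B, and otherwise it
      is a nonzero group with bounded denominators. *)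

From HB Require Import structures.
Require Import Defs.
From mathcomp Require Import all_boot all_order all_algebra.
From mathcomp Require Import generic_quotient ring_quotient.
From mathcomp Require Import all_classical all_reals topology borel_hierarchy.
From mathcomp Require Import freeg.

Set Implicit Arguments.
Unset Strict Implicit.
Unset Printing Implicit Defensive.

Import Order.TTheory GRing.Theory Num.Theory.

Local Open Scope classical_set_scope.
Local Open Scope ring_scope.

(** * The topology of the space of subgroups *)

Section SubGrpTopology.
Variable G : zmodType.
Implicit Types (H K : SubGrp G) (g : G).

(** The topology is induced from [{ptws G -> bool}], where convergence is pointwise and [bool] is
    discrete. *)
Lemma SubGrp_cvg (F : set_system (SubGrp G)) H : Filter F ->
  (forall g, \forall K \near F, \val K g = \val H g) -> F --> H.
Proof.
move=> FF FH U /= [V [[W oW WV] VH VU]].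
have: (fun K : SubGrp G => \val K) @ F --> (\val H : {ptws G -> bool}).
  apply/(@pointwise_cvgP (discrete_topology G) bool) => g A /nbhs_singleton Ag.
  by apply: filterS (FH g) => K /= ->.
move=> /(_ W); have nW : nbhs (\val H : {ptws G -> bool}) W.
  by rewrite nbhsE; exists W => //; split=> //; move: VH; rewrite -WV.
move=> /(_ nW) FW; apply: (@filterS _ F _ _ _ _ FW) => K WK.
by apply: VU; rewrite -WV.
Qed.

Lemma near_SubGrp H g : \forall K \near H, \val K g = \val H g.
Proof.
have cval : continuous (fun K : SubGrp G => \val K : {ptws G -> bool}).
  exact: initial_continuous.
have := @proj_continuous _ (fun=> bool : topologicalType) g (\val H).
move=> /(_ _ (discrete_set1 _)) h.
exact: (cval H _ h).
Qed.

Lemma nbhs_SubGrpP H (A : set (SubGrp G)) :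
  nbhs H A <-> exists s : seq G,
    forall K, (forall g, g \in s -> \val K g = \val H g) -> A K.
Proof.
split=> [HA|[s sA]].
  (* This filter of finite agreement conditions converges to [H], so each neighbourhood contains one
     of them. *)
  pose F := filter_from [set: seq G]
    (fun s => [set K : SubGrp G | forall g, g \in s -> \val K g = \val H g]).
  have FF : Filter F.
    apply: filter_from_filter => [|s t _ _]; first by exists [::].
    exists (s ++ t) => // K /= Kst.
    by split=> g gs; apply: Kst; rewrite mem_cat gs ?orbT.
  have /(_ _ HA)[s _ sA] : F --> H.
    apply: SubGrp_cvg => g; exists [:: g] => // K /= ->//.
    by rewrite inE.
  by exists s => K /sA.
suff: \forall K \near H, forall g, g \in s -> \val K g = \val H g.
  exact: filterS.
elim: s {sA} => [|g s IHs]; first by near=> K => g; rewrite in_nil.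
near=> K => h; rewrite inE => /predU1P[->|hs].
  by near: K; exact: near_SubGrp.
by move: h hs; near: K.
Unshelve. all: by end_near. Qed.

Lemma SubGrp_continuous (Y : topologicalType) (f : Y -> SubGrp G) :
  (forall y g, \forall z \near y, \val (f z) g = \val (f y) g) -> continuous f.
Proof. by move=> fP y; apply: SubGrp_cvg => g; exact: fP. Qed.

Lemma open_mem_SubGrp g : open [set H : SubGrp G | g \in subgroup_pred H].
Proof.
rewrite openE => H /= Hg; apply: filterS (near_SubGrp H g) => K /= Kg.
exact: etrans Kg Hg.
Qed.

End SubGrpTopology.

(** * The space of subgroups is Polish *)

Lemma invS_lt_ex (R : realType) (e : R) : 0 < e -> exists n, n.+1%:R^-1 < e.
Proof.
move=> e0; exists (Num.trunc e^-1).
by rewrite invf_plt ?posrE ?ltr0n// truncnS_gt.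
Qed.

Section SubGrpPolish.
Variables (R : realType) (G : zmodType) (e : nat -> G).
Hypothesis eS : forall g, exists n, e n = g.
Implicit Types H K L : SubGrp G.

Definition agree n H K :=
  all (fun i => \val H (e i) == \val K (e i)) (iota 0 n).

Lemma agreeP n H K :
  reflect (forall i, (i < n)%N -> \val H (e i) = \val K (e i)) (agree n H K).
Proof.
apply: (iffP allP) => HK i; first by move=> ni; apply/eqP/HK; rewrite mem_iota.
by rewrite mem_iota => /HK ->.
Qed.

Lemma eq_agree H K : (forall n, agree n H K) -> H = K.
Proof.
move=> HK; apply: val_inj; apply/funext => g; have [n <-] := eS g.
exact: (agreeP _ _ _ (HK n.+1)).
Qed.

Lemma agree_sym n H K : agree n H K = agree n K H.
Proof. by apply: eq_all => i; rewrite eq_sym. Qed.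

Lemma agree_trans n H K L : agree n H K -> agree n K L -> agree n H L.
Proof. by move=> /agreeP HK /agreeP KL; apply/agreeP => i ni; rewrite HK ?KL. Qed.

Lemma agreexx n H : agree n H H. Proof. exact/agreeP. Qed.

Lemma leq_agree m n H K : (m <= n)%N -> agree n H K -> agree m H K.
Proof.
by move=> mn /agreeP HK; apply/agreeP => i im; apply: HK (leq_trans im mn).
Qed.

Lemma near_agree n H : \forall K \near H, agree n H K.
Proof.
elim: n => [|n IHn]; first by near=> K.
near=> K; apply/agreeP => i; rewrite ltnS leq_eqVlt => /predU1P[->|].
  by apply/esym; near: K; exact: near_SubGrp.
by move: i; apply/agreeP; near: K.
Unshelve. all: by end_near. Qed.

Lemma nbhs_agreeP H (A : set (SubGrp G)) :
  nbhs H A <-> exists n, [set K | agree n H K] `<=` A.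
Proof.
split=> [/nbhs_SubGrpP[s sA]|[n nA]]; last exact: filterS (near_agree n H).
have [c cK] := choice eS.
exists (\max_(g <- s) (c g)).+1 => K /agreeP HK; apply: sA => g gs.
by rewrite -(cK g) HK// ltnS (leq_bigmax_seq (F := c)).
Qed.

(* The least [n] with [~~ agree n H K] is positive, so [0] is only the distance
   of equal subgroups. *)
Definition SubGrp_dist H K : R :=
  if pselect (exists n, ~~ agree n H K) is left ex then (ex_minn ex)%:R^-1 else 0.

(** Turns balls into agreement on an initial segment; the metric, its topology and completeness are
    handled through this equation. *)
Lemma SubGrp_dist_ltP n H K :
  (SubGrp_dist H K < n.+1%:R^-1) = agree n.+1 H K.
Proof.
rewrite /SubGrp_dist; case: pselect => [ex|nex]; last first.
  rewrite invr_gt0 ltr0n; apply/esym/negPn/negP => Hn.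
  by apply: nex; exists n.+1.
(* The minimum is not 0, because [agree 0] is vacuous. *)
case: ex_minnP => -[|m]; first by rewrite /agree.
move=> Hm mmin; rewrite ltf_pV2 ?posrE ?ltr0n// ltr_nat ltnNge.
apply/idP/idP => [|Hn]; last first.
  by apply: contra Hm => mn; exact: leq_agree Hn.
by apply: contraR => /mmin.
Qed.

Lemma SubGrp_dist_ge0 H K : 0 <= SubGrp_dist H K.
Proof. by rewrite /SubGrp_dist; case: pselect => // ex; rewrite invr_ge0. Qed.

Lemma SubGrp_distP H K : SubGrp_dist H K = 0 \/
  exists n, SubGrp_dist H K = n.+1%:R^-1.
Proof.
rewrite /SubGrp_dist; case: pselect => [ex|]; last by left.
by case: ex_minnP => -[|m] _ _; [left; rewrite invr0|right; exists m].
Qed.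

Lemma SubGrp_dist_ultra H K L :
  (SubGrp_dist H L <= SubGrp_dist H K) || (SubGrp_dist H L <= SubGrp_dist K L).
Proof.
have [->|[n HL]] := SubGrp_distP H L; first by rewrite SubGrp_dist_ge0.
have: ~~ agree n.+1 H L by rewrite -SubGrp_dist_ltP HL ltxx.
apply: contraR; rewrite negb_or -!ltNge HL !SubGrp_dist_ltP => /andP[].
exact: agree_trans.
Qed.

Lemma SubGrp_dist_metric : is_metric SubGrp_dist.
Proof.
split=> [H K|H K|H K L].
- split=> [HK|->].
    apply: eq_agree => n; apply: (@leq_agree _ n.+1) => //.
    by rewrite -SubGrp_dist_ltP HK invr_gt0 ltr0n.
  rewrite /SubGrp_dist; case: pselect => // ex.
  by have [n] := ex; rewrite agreexx.
- rewrite /SubGrp_dist; do 2![case: pselect => //] => [ex1 ex2|nex [n Hn]|[n Hn] nex].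
  + congr (_%:R^-1); apply/eqP; rewrite eqn_leq.
    case: ex_minnP => m Hm mmin; case: ex_minnP => m' Hm' mmin'.
    by rewrite mmin 1?agree_sym// mmin' 1?agree_sym.
  + by case: nex; exists n; rewrite agree_sym.
  + by case: nex; exists n; rewrite agree_sym.
- by have /orP[] := SubGrp_dist_ultra H K L => /le_trans; apply;
    rewrite ?lerDl ?lerDr SubGrp_dist_ge0.
Qed.

Lemma SubGrp_dist_induces : metric_induces SubGrp_dist.
Proof.
move=> H A; split=> [/nbhs_agreeP[n nA]|[eps /invS_lt_ex[n neps] HA]].
  exists n.+1%:R^-1; first by rewrite invr_gt0 ltr0n.
  by move=> K /=; rewrite SubGrp_dist_ltP => /(leq_agree (leqnSn n)) /nA.
apply/nbhs_agreeP; exists n.+1 => K /=; rewrite -SubGrp_dist_ltP => HK.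
by apply: HA => /=; exact: lt_trans neps.
Qed.

(** Along a Cauchy sequence, membership of each fixed element is eventually constant; the eventual
    values form the limit subgroup. *)
Lemma SubGrp_dist_complete : metric_complete SubGrp_dist.
Proof.
move=> u uC.
have: forall g, exists N, forall m, (N <= m)%N -> \val (u m) g = \val (u N) g.
  move=> g; have [n <-] := eS g.
  have [|N NP] := uC n.+1%:R^-1; first by rewrite invr_gt0 ltr0n.
  exists N => m Nm; have := NP _ _ Nm (leqnn N).
  by rewrite SubGrp_dist_ltP => /agreeP; apply.
move=> /choice[N NP].
pose A : {ptws G -> bool} := fun g => \val (u (N g)) g.
have AE g m : (N g <= m)%N -> A g = \val (u m) g by move=> Nm; rewrite NP.
have AP : subgroups A.
  split=> [|x y xA yA].
    by have [h _] := subgroup_pred_zmod_closed (u (N 0)).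
  (* A single term [u m] past the stabilization of [x], [y] and [x - y] passes its closure on to
     [A]. *)
  pose m := (N x + N y + N (x - y)%R)%N.
  have [_ h] := subgroup_pred_zmod_closed (u m).
  have mA z : (N z <= m)%N -> (z \in A) = (z \in subgroup_pred (u m)).
    exact: AE.
  rewrite mA ?leq_addl//; apply: h; rewrite -mA//.
    by rewrite /m -addnA leq_addr.
  by rewrite /m -addnA addnCA leq_addr.
exists (SigSub (mem_set AP)); apply: SubGrp_cvg => g.
by exists (N g) => // m /= Nm; rewrite -(AE _ _ Nm).
Qed.

(** One subgroup is chosen for each realizable finite membership pattern; the other patterns get the
    whole group by default. *)
Lemma SubGrp_separable : separable (SubGrp G).
Proof.
pose P (s : seq bool) K := forall i, (i < size s)%N -> \val K (e i) = nth false s i.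
have: forall s, exists K, (exists L, P s L) -> P s K.
  move=> s; have [[L PL]|nP] := pselect (exists L, P s L); first by exists L.
  have TP : subgroups ((fun=> true) : {ptws G -> bool}) by [].
  by exists (SigSub (mem_set TP)).
move=> /choice[f fP]; exists (range f).
  exact: card_le_trans (card_image_le _ _) (countableP _).
move=> O [H OH] oO.
have /nbhs_agreeP[n nO] : nbhs H O by exact: open_nbhs_nbhs.
pose s := mkseq (fun i => \val H (e i)) n.
have Hs : P s (f s).
  apply: fP; exists H => i; rewrite size_mkseq => ni.
  by rewrite nth_mkseq.
exists (f s); split; last by exists s.
apply: nO; apply/agreeP => i ni.
by rewrite Hs ?size_mkseq// nth_mkseq.
Qed.

Lemma SubGrp_polish : polish R (SubGrp G).
Proof.
split; first exact: SubGrp_separable.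
exists SubGrp_dist; split.
- exact: SubGrp_dist_metric.
- exact: SubGrp_dist_induces.
- exact: SubGrp_dist_complete.
Qed.

End SubGrpPolish.

(** * Clopen decompositions *)

(** For each code of a point of the dense set and each radius 1/(n+1), choose a clopen subset of [U]
    containing that ball, if there is one. These countably many sets exhaust [U]. *)
Lemma open_bigcup_clopen (R : realType) (Y : topologicalType) (U : set Y) :
  polish R Y -> clopen_basis Y -> open U ->
  exists2 C : nat -> set Y, (forall k, clopen (C k)) & U = \bigcup_k C k.
Proof.
move=> [[D /countable_injP[a ainj] dD] [d [[d0 dC dT] dI _]]] [B [_ Bb] Bc] oU.
pose P (p : nat * nat) (C : set Y) := [/\ clopen C, C `<=` U &
  exists x, [/\ D x, a x = p.1 & [set y | d x y < p.2.+1%:R^-1] `<=` C]].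
have: forall p, exists C, [/\ clopen C, C `<=` U & (exists V, P p V) -> P p C].
  move=> p; have [[V PV]|nP] := pselect (exists V, P p V).
    by exists V; have [? ? _] := PV; split.
  by exists set0; split=> //; exact: clopen0.
move=> /choice[C CP].
exists (fun k => if unpickle k is Some p then C p else set0).
  by move=> k; case: unpickle => [p|]; [have [] := CP p|exact: clopen0].
apply/seteqP; split=> [y Uy|y [k _]]; last first.
  by case: unpickle => // p; have [_ + _] := CP p; apply.
have [V [BV Vy] VU] : filter_from [set V | B V /\ V y] id U.
  by apply: (Bb y); exact: open_nbhs_nbhs.
have [e e0 eV] : exists2 e : R, 0 < e & [set z | d y z < e] `<=` V.
  by apply/dI/open_nbhs_nbhs; split=> //; have [] := Bc _ BV.
(* With radius below [e / 2], the ball around a dense point [x] this close to [y] stays inside the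
   [e]-ball of [y]. *)
have [n ne] := invS_lt_ex (divr_gt0 e0 (ltr0Sn _ 1)).
have n0 : 0 < n.+1%:R^-1 :> R by rewrite invr_gt0.
have [x [yx Dx]] : [set z | d y z < n.+1%:R^-1]° `&` D !=set0.
  apply: dD; last exact: open_interior.
  by exists y; apply/dI; exists n.+1%:R^-1.
have {}yx := interior_subset yx.
have [_ _ /(_ _)[|_ _ [z [Dz az zC]]]] := CP (a x, n).
  exists V; split=> //; first exact: Bc.
  exists x; split=> // z /= xz; apply: eV => /=.
  apply: le_lt_trans (dT y x z) _; rewrite [ltRHS]splitr.
  by apply: ltrD; [exact: lt_trans ne|exact: lt_trans ne].
have xz : z = x by apply: ainj; rewrite ?inE.
exists (pickle (a x, n)) => //; rewrite pickleK; apply: zC => /=.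
by rewrite xz dC.
Qed.

(** Membership in a clopen set is locally constant, so the clopen pieces of the n-th open set serve
    as the events of row [n]. *)
Lemma Gdelta_local_hits (R : realType) (Y : topologicalType) (B : set Y) :
  polish R Y -> clopen_basis Y -> Gdelta B ->
  exists2 c : nat -> nat -> Y -> bool,
    (forall n k y, \forall z \near y, c n k z = c n k y) &
    forall y, B y <-> forall n, exists k, c n k y.
Proof.
move=> polY cbY [U oU ->].
have /choice[C CP] : forall n, exists C : nat -> set Y,
    (forall k, clopen (C k)) /\ U n = \bigcup_k C k.
  by move=> n; have [C] := open_bigcup_clopen polY cbY (oU n); exists C.
exists (fun n k y => `[< C n k y >]) => [n k y|y].
  have [/(_ k)[oC cC] _] := CP n.
  have [Cy|nCy] := pselect (C n k y).
    apply: filterS (open_nbhs_nbhs (conj oC Cy)) => z Cz.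
    by rewrite !asboolT.
  have oC' : open (~` C n k) by rewrite openC.
  apply: filterS (open_nbhs_nbhs (conj oC' nCy)) => z Cz.
  by rewrite !asboolF.
split=> [Uy n|hy n _].
  have [_ UE] := CP n; have := Uy n I; rewrite UE => -[k _ Cy].
  by exists k; apply/asboolP.
have [_ ->] := CP n; have [k /asboolP] := hy n.
by exists k.
Qed.

(** * Torsion and divisible quotients *)

Section Quotients.
Variables (G : zmodType) (e : nat -> G).
Hypothesis eS : forall g, exists n, e n = g.
Implicit Types H K : SubGrp G.

(** Lets torsion and divisibility of the quotient be restated inside [G]. *)
Lemma quotient_group_proj H : exists2 p : {additive G -> quotient_group H},
  (forall x, exists g, p g = x) & forall g, p g = 0 <-> g \in subgroup_pred H.
Proof.
exists (\pi_(Quotient.quot (subgroup_pred H))%qT) => [x|g].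
  by exists (repr (x : Quotient.quot (subgroup_pred H))); exact: reprK.
have := Quotient.idealrBE (subgroup_pred H) g 0; rewrite subr0 raddf0 => ->.
by split=> /eqP.
Qed.

Lemma torsion_quotientP H : torsion_group (quotient_group H) <->
  forall g, exists2 n, (0 < n)%N & g *+ n \in subgroup_pred H.
Proof.
have [p pS p0] := quotient_group_proj H; split=> [tH g|tH x].
  by have [n n0 gn] := tH (p g); exists n => //; apply/p0; rewrite raddfMn.
have [g <-] := pS x; have [n n0 /p0 gn] := tH g.
by exists n; rewrite // -raddfMn.
Qed.

Lemma divisible_quotientP H : divisible_group (quotient_group H) <->
  forall n g, (0 < n)%N -> exists h, h *+ n - g \in subgroup_pred H.
Proof.
have [p pS p0] := quotient_group_proj H; split=> [dH n g n0|dH n n0 x].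
  have [x xn] := dH n n0 (p g); have [h hx] := pS x; exists h.
  by apply/p0; rewrite raddfB raddfMn hx xn subrr.
have [g <-] := pS x; have [h /p0 hn] := dH n g n0.
by exists (p h); apply/eqP; rewrite -subr_eq0 -raddfMn -raddfB hn.
Qed.

Lemma Gdelta_torsion :
  Gdelta [set H : SubGrp G | torsion_group (quotient_group H)].
Proof.
exists (fun i => \bigcup_(n in [set n | (0 < n)%N])
                   [set H : SubGrp G | e i *+ n \in subgroup_pred H]).
  by move=> i; apply: bigcup_open => n _; exact: open_mem_SubGrp.
apply/seteqP; split=> [H /= /torsion_quotientP tH i _|H tH /=].
  by have [n n0 en] := tH (e i); exists n.
apply/torsion_quotientP => g; have [i <-] := eS g.
by have [n n0 en] := tH i I; exists n.
Qed.

Lemma Gdelta_divisible :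
  Gdelta [set H : SubGrp G | divisible_group (quotient_group H)].
Proof.
(* The index codes the divisor [n.+1], hence positive, and the element [e j]; indices that code
   nothing impose no condition. *)
exists (fun i => if unpickle i is Some (n, j) then
  \bigcup_h [set H : SubGrp G | h *+ n.+1 - e j \in subgroup_pred H] else setT).
  move=> i; case: unpickle => [[n j]|]; last exact: openT.
  by apply: bigcup_open => h _; exact: open_mem_SubGrp.
apply/seteqP; split=> [H /= /divisible_quotientP dH i _|H dH /=].
  case: unpickle => [[n j]|]//.
  by have [//|h hn] := dH n.+1 (e j); exists h.
apply/divisible_quotientP => -[//|n] g _; have [j <-] := eS g.
have := dH (pickle (n, j)) I; rewrite pickleK => -[h _ hn].
by exists h.
Qed.

End Quotients.

(** * Reductions *)

Lemma ZN_enum : exists e : nat -> ZN, forall g, exists n, e n = g.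
Proof.
exists (fun n => if unpickle n is Some s then [freeg s] else 0) => g.
by exists (pickle (fgenum g)); rewrite pickleK Freeg_enum.
Qed.

Lemma near_all_seq (Y : topologicalType) (T : eqType) (y : Y) (s : seq T)
    (P : T -> Y -> Prop) :
  (forall t, \forall z \near y, P t z) ->
  \forall z \near y, forall t, t \in s -> P t z.
Proof.
move=> Py; elim: s => [|t s IHs]; first by near=> z => t; rewrite in_nil.
near=> z => u; rewrite inE => /predU1P[->|us]; first by near: z; exact: Py.
by move: u us; near: z.
Unshelve. all: by end_near. Qed.

(* [0] if [a] is nowhere true, so that [dvdz] then only holds for [0]. *)
Definition hit_modulus (a : nat -> bool) : nat :=
  if pselect (exists k, a k) is left ex then (ex_minn ex).+1 else 0.

Lemma hit_modulus_gt0 a : (0 < hit_modulus a)%N <-> exists k, a k.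
Proof. by rewrite /hit_modulus; case: pselect. Qed.

(** If k + 1 divides a nonzero [d], then [k] is below the absolute value of [d], so the first hit of
    [a] lies where [a] and [b] agree and is also the first hit of [b]. *)
Lemma dvd_hit_modulus_sub a b (d : int) : d != 0 ->
  (forall k, (k < `|d|)%N -> a k = b k) ->
  (hit_modulus a %| d)%Z -> (hit_modulus b %| d)%Z.
Proof.
move=> d0 ab; rewrite {1}/hit_modulus.
case: pselect => [ex|_]; last by rewrite dvd0z (negbTE d0).
case: ex_minnP => k ak kmin kd.
have kltd : (k < `|d|)%N by rewrite dvdn_leq ?absz_gt0.
rewrite /hit_modulus; case: pselect => [exb|[]]; last by exists k; rewrite -ab.
case: ex_minnP => l bl lmin; suff -> : l = k by [].
have lk : (l <= k)%N by rewrite lmin// -ab.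
by apply/eqP; rewrite eqn_leq lk kmin// ab// (leq_ltn_trans lk).
Qed.

Lemma dvd_hit_modulus_local a b (d : int) :
  (forall k, (k < `|d|)%N -> a k = b k) ->
  (hit_modulus a %| d)%Z = (hit_modulus b %| d)%Z.
Proof.
have [->|d0] := eqVneq d 0; first by rewrite !dvdz0.
move=> ab; apply/idP/idP; apply: dvd_hit_modulus_sub => // k kd.
by rewrite ab.
Qed.

Section Reductions.
Variables (Y : topologicalType) (c : nat -> nat -> Y -> bool).
Hypothesis c_local : forall n k y, \forall z \near y, c n k z = c n k y.

(** * The reduction to torsion quotients *)

Definition torsion_modulus y n := hit_modulus (fun k => c n k y).

Definition torsion_subgroup y : {ptws ZN -> bool} :=
  fun x => all (fun n => (torsion_modulus y n %| coeff n x)%Z) (dom x).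

Lemma torsion_subgroupP y x : reflect
  (forall n, (torsion_modulus y n %| coeff n x)%Z) (torsion_subgroup y x).
Proof.
apply: (iffP allP) => h n; last by [].
by have [/h//|/coeff_outdom ->] := boolP (n \in dom x); rewrite dvdz0.
Qed.

Lemma torsion_subgroup_closed y : subgroups (torsion_subgroup y).
Proof.
split=> [|u v /torsion_subgroupP yu /torsion_subgroupP yv].
  by apply/torsion_subgroupP => n; rewrite coeff0 dvdz0.
by apply/torsion_subgroupP => n; rewrite coeffB rpredB.
Qed.

Definition torsion_reduction y : SubGrp ZN :=
  SigSub (mem_set (torsion_subgroup_closed y)).

Lemma torsion_reduction_continuous : continuous torsion_reduction.
Proof.
apply: SubGrp_continuous => y g.
have : \forall z \near y, forall n, n \in dom g -> forall k,
    k \in iota 0 `|coeff n g| -> c n k z = c n k y.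
  by apply: near_all_seq => n; apply: near_all_seq => k.
apply: filterS => z cz; apply: eq_in_all => n ng.
by apply: dvd_hit_modulus_local => k kg; apply: cz => //; rewrite mem_iota.
Qed.

Lemma torsion_reductionP y : torsion_group (quotient_group (torsion_reduction y))
  <-> forall n, exists k, c n k y.
Proof.
rewrite torsion_quotientP; split=> [tH n|hy g].
  (* A positive multiple [m] of the n-th generator lies in the subgroup, so the modulus divides [m]
     and cannot be 0. *)
  have [m m0 /torsion_subgroupP/(_ n)] := tH << n >>.
  rewrite coeffMn coeffU eqxx mulr1 => mn; apply/hit_modulus_gt0.
  move: mn; rewrite /torsion_modulus; case: hit_modulus => //.
  by rewrite dvd0z pnatr_eq0 eqn0Ngt m0.
(* The product over the finite support annihilates every coordinate at once. *)
exists (\prod_(n <- dom g) torsion_modulus y n)%N.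
  by apply: prodn_gt0 => n; exact/hit_modulus_gt0.
apply/allP => n _; rewrite coeffMn -mulr_natr.
have [ng|/coeff_outdom ->] := boolP (n \in dom g); last by rewrite mul0r dvdz0.
rewrite natz dvdz_mull// dvdzE /= (bigD1_seq n)//= ?uniq_dom//.
exact: dvdn_mulr.
Qed.

(** * The reduction to divisible quotients *)

Definition hits n k y := all (fun j => has (fun i => c j i y) (iota 0 k)) (iota 0 n).

Lemma hits_local n k y : \forall z \near y, hits n k z = hits n k y.
Proof.
have : \forall z \near y, forall j, j \in iota 0 n -> forall i,
    i \in iota 0 k -> c j i z = c j i y.
  by apply: near_all_seq => j; apply: near_all_seq => i.
by apply: filterS => z cz; apply: eq_in_all => j /cz h; exact: eq_in_has.
Qed.

(** The time bound [k] in the code makes each weight depend on finitely many events, hence locally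
    constant in [y]. *)
Definition divisible_weight y i : zmodule rat :=
  if unpickle i is Some (n, k) then
    if hits n k y then (n`!%:R : rat)^-1 else 1
  else 1.

Lemma divisible_weight_local i y :
  \forall z \near y, divisible_weight z i = divisible_weight y i.
Proof.
rewrite /divisible_weight; case: unpickle => [[n k]|]; last by near=> z.
by apply: filterS (hits_local n k y) => z ->.
Unshelve. all: by end_near. Qed.

Definition divisible_hom y : ZN -> rat := fglift (divisible_weight y).

Lemma divisible_homE y x :
  divisible_hom y x = \sum_(t <- fgenum x) divisible_weight y t.2 *~ t.1 :> rat.
Proof. by rewrite /divisible_hom -{1}[x]Freeg_enum fglift_Freeg. Qed.

Lemma divisible_hom_is_additive y : additive (divisible_hom y).
Proof. exact: (@lift_is_additive int nat (zmodule rat) (divisible_weight y)). Qed.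

HB.instance Definition _ y :=
  GRing.isZmodMorphism.Build ZN rat (divisible_hom y)
    (divisible_hom_is_additive y).

Lemma divisible_subgroup_closed y :
  subgroups ((fun x => divisible_hom y x == 0) : {ptws ZN -> bool}).
Proof.
split=> [|u v /eqP yu /eqP yv]; rewrite unfold_in; first by rewrite raddf0.
by rewrite raddfB /= yu yv subr0.
Qed.

Definition divisible_reduction y : SubGrp ZN :=
  SigSub (mem_set (divisible_subgroup_closed y)).

Lemma divisible_reduction_continuous : continuous divisible_reduction.
Proof.
apply: SubGrp_continuous => y g.
have : \forall z \near y, forall t, t \in fgenum g ->
    divisible_weight z t.2 = divisible_weight y t.2.
  by apply: near_all_seq => t; exact: divisible_weight_local.
apply: filterS => z wz /=; rewrite !divisible_homE; congr (_ == 0).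
by apply: eq_big_seq => t /wz ->.
Qed.

Lemma divisible_reductionP y :
  divisible_group (quotient_group (divisible_reduction y)) <->
  forall n, exists k, c n k y.
Proof.
have memE x : x \in subgroup_pred (divisible_reduction y) =
    (divisible_hom y x == 0) by [].
have homU k i : divisible_hom y << k *g i >> = divisible_weight y i *~ k :> rat.
  exact: (@liftU int (zmodule rat) nat).
rewrite divisible_quotientP; split=> [dH n|hy n g n0].
  apply: contrapT => nhit.
  (* Row [n] is never hit, so only weights 1/m! with m at most n occur, and n! clears all
     denominators. *)
  have hitsF m k : hits m k y -> (m <= n)%N.
    move=> /allP hm; rewrite leqNgt; apply/negP => nm; apply: nhit.
    have /hasP[i _ ci] := hm n ltac:(by rewrite mem_iota).
    by exists i.
  have fact_int x : divisible_hom y x * n`!%:R \is a Num.int.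
    rewrite divisible_homE mulr_suml rpred_sum// => t _.
    rewrite mulrzAl rpredMz// /divisible_weight.
    case: unpickle => [[m k]|]; last by rewrite mul1r natr_int.
    case: ifP => [/hitsF mn|]; last by rewrite mul1r natr_int.
    rewrite -(bin_fact mn) mulnCA natrM mulKf ?natr_int//.
    by rewrite pnatr_eq0 -lt0n fact_gt0.
  (* This generator has weight 1/0! = 1, as [hits 0 0] is vacuous. Dividing it by 2 n! would give 2z
     = 1 for the integer z = n! times the value at [h], against parity. *)
  have [|h] := dH (2 * n`!)%N << pickle (0%N, 0%N) >>.
    by rewrite muln_gt0 fact_gt0.
  rewrite memE raddfB raddfMn /= homU /divisible_weight pickleK /= fact0 invr1.
  have /intrP[z zE] := fact_int h.
  rewrite mulnC mulrnA -[_ *+ n`!]mulr_natr zE mulr1z subr_eq0 -rmorphMn /=.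
  rewrite -[1]/(1%:~R) eqr_int => /eqP/(congr1 (fun a : int => odd `|a|)).
  by rewrite -mulr_natr abszM oddM andbF.
(* It suffices to find a preimage of [r]. Its denominator [m] divides m!, so a generator of weight
   1/m! is enough. *)
pose r := divisible_hom y g / n%:R; pose m := `|denq r|%N.
have m0 : (0 < m)%N by rewrite absz_gt0 denq_neq0.
have [K cK] := choice hy.
(* The successor is needed because [hits] looks only at times strictly below its bound. *)
have hmk : hits m (\max_(j < m) K j).+1 y.
  apply/allP => j; rewrite mem_iota => /andP[_ jm]; apply/hasP; exists (K j) => //.
  by rewrite mem_iota ltnS (leq_bigmax (Ordinal jm)).
(* The coefficient comes from (m-1)!/m! = 1/m. *)
exists << numq r * (m.-1)`!%:Z *g pickle (m, (\max_(j < m) K j).+1) >>.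
rewrite memE raddfB raddfMn /= homU /divisible_weight pickleK hmk.
suff -> : (m`!%:R^-1 : rat) *~ (numq r * (m.-1)`!%:Z) = r.
  by rewrite -mulr_natr divfK ?subrr// pnatr_eq0 -lt0n.
rewrite -[RHS]divq_num_den -mulrzr intrM mulrCA; congr (_ * _).
rewrite -(prednK m0) factS prednK// natrM invfM -mulrA mulVf ?mulr1.
  by rewrite /m -[denq r]gez0_abs ?denq_ge0.
by rewrite pnatr_eq0 -lt0n fact_gt0.
Qed.

End Reductions.

Theorem theorem12p8 (R : realType) :
  Pi02_complete R [set H : SubGrp ZN | torsion_group (quotient_group H)] /\
  Pi02_complete R [set H : SubGrp ZN | divisible_group (quotient_group H)].
Proof.
have [e eS] := ZN_enum; have polZN := SubGrp_polish R eS.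
split; split=> //; [exact: Gdelta_torsion| |exact: Gdelta_divisible|];
  move=> Y B polY cbY /(Gdelta_local_hits polY cbY)[c c_local BE].
- exists (torsion_reduction c); first exact: torsion_reduction_continuous.
  by apply/seteqP; split=> y /=; rewrite torsion_reductionP BE.
- exists (divisible_reduction c); first exact: divisible_reduction_continuous.
  by apply/seteqP; split=> y /=; rewrite divisible_reductionP BE.
Qed.
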